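(* Let $b\ge 2$ be an integer, let $\xi\neq 1$ be a complex number with $\xi^b=1$, let $r\ge 1$ and let $N_1,\dots,N_r$ be positive integers. Then for all $x_1,\dots,x_r,y_1,\dots,y_r\in\mathbb{C}$, $$\sum_{n_{1}=0}^{b^{N_{1}}-1}\cdots\sum_{n_{r}=0}^{b^{N_{r}}-1}\xi^{\sum_{j=1}^{r}s_{b}(n_{j})}\left(\sum_{j=1}^{r}\big(s_{b}(n_j)x_j+n_{j}y_{j}\big)\right)^{\sum_{j=1}^{r}N_{j}}=\left(\frac{b}{\xi-1}\right)^{\sum_{j=1}^{r}N_{j}}\Big(\sum_{j=1}^{r}N_{j}\Big)!\prod_{j=1}^r\prod_{i_j=0}^{N_j-1}\big(x_j+b^{i_j}y_j\big).$$ As a consequence (case $b=2$, $\xi=-1$), $$\sum_{n_{1}=0}^{2^{N_{1}}-1}\cdots\sum_{n_{r}=0}^{2^{N_{r}}-1}(-1)^{\sum_{j=1}^{r}s_{2}(n_{j})}\left(\sum_{j=1}^{r}\big(s_2(n_j)x_j+n_{j}y_{j}\big)\right)^{\sum_{j=1}^{r}N_{j}}=(-1)^{\sum_{j=1}^{r}N_{j}}\Big(\sum_{j=1}^{r}N_{j}\Big)!\prod_{j=1}^r\prod_{i_j=0}^{N_j-1}\big(x_j+2^{i_j}y_j\big).$$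
   Context: For a nonnegative integer $n$ and an integer $b\ge2$, $s_b(n)$ denotes the sum of the digits of $n$ in base $b$. *)

(* Defs.v *)
From mathcomp Require Import all_boot.

Set Implicit Arguments.
Unset Strict Implicit.
Unset Printing Implicit Defensive.

(* The digit of n at position i in base b is (n %/ b ^ i) %% b. For b >= 2 we
   have n < b ^ n, so every digit at a position i >= n is 0 and the sum may stop
   at n. *)
Definition digit_sum (b n : nat) : nat := \sum_(i < n) (n %/ b ^ i) %% b.

(* Main.v *)
Require Import Defs.
From mathcomp Require Import all_boot all_order all_algebra.
From mathcomp Require Import reals.
From mathcomp Require Import complex.
From mathcomp Require Import ring.

Set Implicit Arguments.
Unset Strict Implicit.
Unset Printing Implicit Defensive.

Import Order.TTheory GRing.Theory Num.Theory.
Local Open Scope ring_scope.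
Local Open Scope complex_scope.

(** Expand the power with exponentials.  Put M = \sum_j N j and, for a linear
    form c, read c ^ M as M! times the coefficient of t ^ M in exp (c t).
    Since exp turns sums into products, the generating series of the
    left-hand side factors, first over the indices j (distributivity), then
    over the digits of each n_j (splitting off the last digit replaces y by
    b y).  What remains is a product of M series, one for each pair (j, i),
    of the form
      \sum_(d < b) xi ^ d * exp (d a t),   a = x_j + b ^ i y_j.
    The constant term of such a factor is \sum_(d < b) xi ^ d = 0, and its
    linear coefficient is a * \sum_(d < b) d xi ^ d = a * b / (xi - 1).
    So the product of all M factors has no terms below t ^ M, and its
    coefficient at t ^ M is the product of the M linear coefficients; this is
    the right-hand side divided by M!.

    Only the coefficients up to t ^ M matter, so power series truncated after
    t ^ M are represented by upper triangular Toeplitz matrices of size M + 1,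
    the coefficient of t ^ k standing on the k-th superdiagonal.  In this way
    exp ((a + b) t) = exp (a t) exp (b t) is an exact identity ([texpD]).  The
    three steps are [sum_dffun_texp], [sum_digits_texp] and
    [has_lead_digit_factor]. *)

(** * Digit sums *)

Section DigitSum.

Variable b : nat.
Hypothesis b_gt1 : (1 < b)%N.

(** Frees the number of digit positions from n itself, so that digit sums of
    different numbers can be compared position by position. *)
Lemma digit_sum_widen n k :
  (n <= k)%N -> digit_sum b n = (\sum_(i < k) (n %/ b ^ i) %% b)%N.
Proof.
move=> le_nk; rewrite /digit_sum -!(big_mkord predT (fun i => (n %/ b ^ i) %% b)%N).
rewrite [RHS](big_cat_nat (n := n)) //= [X in (_ + X)%N]big_nat_cond.
rewrite [X in (_ + X)%N]big1 ?addn0 // => i /andP[/andP[le_ni _] _].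
rewrite divn_small ?mod0n //.
exact: leq_ltn_trans le_ni (ltn_expl _ b_gt1).
Qed.

Lemma digit_sumMD q d :
  (d < b)%N -> digit_sum b (q * b + d) = (digit_sum b q + d)%N.
Proof.
move=> lt_db; have b_gt0 : (0 < b)%N by apply: ltnW.
have le_q : (q <= q * b + d)%N by rewrite (leq_trans (leq_pmulr q b_gt0)) ?leq_addr.
rewrite (digit_sum_widen (leqnSn _)) big_ord_recl expn0 divn1 modnMDl modn_small //.
rewrite (digit_sum_widen le_q) addnC; congr (_ + _)%N; apply: eq_bigr => i _.
by rewrite /= /bump /= add1n expnS divnMA divnMDl // (divn_small lt_db) addn0.
Qed.

End DigitSum.

(** * Sums weighted by powers of a root of unity *)

Section RootOfUnity.

Variables (K : fieldType) (b : nat) (xi : K).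
Hypotheses (xi_neq1 : xi != 1) (xib1 : xi ^+ b = 1).

Lemma sum_root_of_unity : \sum_(d < b) xi ^+ d = 0.
Proof.
have /eqP := subrX1 xi b; rewrite xib1 subrr eq_sym mulf_eq0 subr_eq0.
by rewrite (negPf xi_neq1) => /eqP.
Qed.

Lemma sum_natr_root_of_unity : \sum_(d < b) d%:R * xi ^+ d = b%:R / (xi - 1).
Proof.
have xi1 : xi - 1 != 0 by rewrite subr_eq0.
(* Abel summation, for every upper bound *)
have abel n : (xi - 1) * (\sum_(d < n) d%:R * xi ^+ d)
              = n%:R * xi ^+ n - xi * \sum_(d < n) xi ^+ d.
  elim: n => [|n IHn]; first by rewrite !big_ord0; ring.
  rewrite !big_ord_recr /= mulrDr IHn mulrDr exprS.
  by rewrite -[n.+1]addn1 natrD; ring.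
apply: (mulfI xi1); rewrite abel sum_root_of_unity xib1.
by field.
Qed.

End RootOfUnity.

(** * Distributivity over a dependent product of finite types *)

(** All T i embed into the single finite type {i : I & T i}, where
    distributivity is known for non-dependent functions;
    the choice functions among them, those sending i to a value tagged i,
    correspond to the dependent ones. *)
Lemma bigA_distr_dffun (R : pzSemiRingType) (I : finType) (T : I -> finType)
    (F : forall i, T i -> R) :
  \prod_i \sum_(k : T i) F i k
  = \sum_(f : {dffun forall i, T i}) \prod_i F i (f i).
Proof.
pose P i := [ffun k => F i k].
transitivity (\prod_i \sum_(k in tagged_with T i) untag 0 (P i) k).
  by apply: eq_bigr => i _; rewrite -(big_tag P); apply: eq_bigr => k _; rewrite ffunE.
rewrite bigA_distr_big_dep -(big_fprod _ _ P).
rewrite (reindex (@fprod_of_dffun _ T)); last exact/onW_bij/fprod_of_dffun_bij.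
by apply: eq_bigr => f _; apply: eq_bigr => i _; rewrite fprodE ffunE.
Qed.

(** * Truncated power series as Toeplitz matrices *)

Section TruncatedSeries.

Variables (K : numFieldType) (M : nat).
Implicit Types (a c : K) (A B : 'M[K]_M.+1).

(** The series exp (a t), truncated after t ^ M. *)
Definition texp a : 'M[K]_M.+1 :=
  \matrix_(i, j) if (i <= j)%N then a ^+ (j - i) / (j - i)`!%:R else 0.

Lemma texp0 : texp 0 = 1.
Proof.
apply/matrixP=> i j; rewrite !mxE -val_eqE /=.
case: ltngtP => [lt_ij|//|->]; last by rewrite subnn expr0 fact0 divr1.
by rewrite expr0n subn_eq0 leqNgt lt_ij mul0r.
Qed.

Lemma expD_coef a c n :
  \sum_(k < n.+1) (a ^+ k / k`!%:R) * (c ^+ (n - k) / (n - k)`!%:R)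
  = (a + c) ^+ n / n`!%:R.
Proof.
have fact_neq0 m : m`!%:R != 0 :> K by rewrite pnatr_eq0 -lt0n fact_gt0.
rewrite [a + c]addrC exprDn mulr_suml; apply: eq_bigr => k _.
have le_kn : (k <= n)%N by rewrite -ltnS.
rewrite -mulr_natr -(bin_fact le_kn) !natrM.
have bin_neq0 : 'C(n, k)%:R != 0 :> K by rewrite pnatr_eq0 -lt0n bin_gt0.
by field; rewrite bin_neq0 !fact_neq0.
Qed.

Lemma texpD a c : texp (a + c) = texp a * texp c.
Proof.
apply/matrixP=> i j; rewrite !mxE.
pose F h : K := (if (i <= h)%N then a ^+ (h - i) / (h - i)`!%:R else 0) *
                (if (h <= j)%N then c ^+ (j - h) / (j - h)`!%:R else 0).
rewrite (eq_bigr (fun h : 'I_M.+1 => F h)) => [|h _]; last by rewrite !mxE.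
case: leqP => [le_ij|lt_ji]; last first.
  rewrite big1 // => h _; rewrite /F; case: leqP => [le_ih|]; last by rewrite mul0r.
  by rewrite leqNgt (leq_trans lt_ji le_ih) mulr0.
(* the terms with h < i or j < h vanish; then shift the index by i *)
rewrite -(big_mkord predT F) (big_cat_nat (n := i)) ?(ltnW (ltn_ord i)) //=.
rewrite big_nat_cond big1 ?add0r => [|h]; last first.
  by rewrite andbT /F => /andP[_ lt_hi]; rewrite leqNgt lt_hi mul0r.
rewrite (big_cat_nat (n := j.+1)) ?(leq_trans le_ij) //=.
rewrite [X in _ = _ + X]big_nat_cond [X in _ = _ + X]big1 ?addr0 => [|h]; last first.
  by rewrite andbT /F => /andP[lt_jh _]; rewrite [(h <= j)%N]leqNgt lt_jh mulr0.
rewrite -[in RHS](add0n i) big_addn subSn // big_mkord -expD_coef.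
apply: eq_bigr => k _; have le_kij : (k + i <= j)%N.
  by rewrite addnC -leq_subRL // -ltnS.
by rewrite /F leq_addl addnK le_kij addnC subnDA.
Qed.

Lemma texp_sum (I : finType) (f : I -> K) :
  texp (\sum_i f i) = \prod_i texp (f i).
Proof. exact: (big_morph texp texpD texp0). Qed.

(** The series A is c t ^ k plus terms of higher order, where c may be 0.
    Entries are prescribed only up to the k-th superdiagonal, and A need not
    be Toeplitz: the top right entry for k = M is all that is read off in the
    end, and the condition is stable under products. *)
Definition has_lead k c A :=
  forall i j : 'I_M.+1, (j <= i + k)%N -> A i j = if (j == i + k :> nat)%N then c else 0.

Lemma has_lead1 : has_lead 0 1 1.
Proof. by move=> i j; rewrite addn0 !mxE -val_eqE /= eq_sym; case: eqP. Qed.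

(** In \sum_h A i h * B h j with j = i + k + l, a summand with h < i + k has
    A i h = 0 and one with h > i + k has B h j = 0. *)
Lemma has_leadM k l c d A B :
  has_lead k c A -> has_lead l d B -> has_lead (k + l) (c * d) (A * B).
Proof.
move=> Ac Bd i j; rewrite addnA => le_j; rewrite mxE.
have small (h : 'I_M.+1) : (h < i + k)%N -> A i h = 0.
  by move=> lt_h; rewrite Ac ?(ltnW lt_h) // ltn_eqF.
have large (h : 'I_M.+1) : (j < h + l)%N -> B h j = 0.
  by move=> lt_j; rewrite Bd ?(ltnW lt_j) // ltn_eqF.
case: eqP => [j_eq|/eqP j_neq]; last first.
  have lt_j : (j < i + k + l)%N by rewrite ltn_neqAle j_neq.
  apply: big1 => h _; have [/small->|le_h] := ltnP h (i + k); first by rewrite mul0r.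
  by rewrite large ?mulr0 // (leq_trans lt_j) ?leq_add2r.
have lt_ik : (i + k < M.+1)%N by rewrite (leq_ltn_trans _ (ltn_ord j)) // j_eq leq_addr.
rewrite (bigD1 (Ordinal lt_ik)) //= Ac // Bd /= ?j_eq // !eqxx big1 ?addr0 // => h.
rewrite -val_eqE /= neq_ltn => /orP[/small->|lt_h]; first by rewrite mul0r.
by rewrite large ?mulr0 // j_eq ltn_add2r.
Qed.

Lemma has_lead_prod (I : finType) (k : I -> nat) (c : I -> K) (A : I -> 'M[K]_M.+1) :
  (forall i, has_lead (k i) (c i) (A i)) ->
  has_lead (\sum_i k i)%N (\prod_i c i) (\prod_i A i).
Proof.
move=> kcA; elim/big_rec3: _ => [|i B d l _ lead_B]; first exact: has_lead1.
exact: has_leadM.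
Qed.

(** The generating series of one digit of weight a has constant term
    \sum_(d < b) xi ^ d = 0, so each digit contributes one factor t. *)
Lemma has_lead_digit_factor b (xi a : K) :
  xi != 1 -> xi ^+ b = 1 ->
  has_lead 1 (b%:R / (xi - 1) * a) (\sum_(d < b) xi ^+ d *: texp (d%:R * a)).
Proof.
move=> xi1 xib1 i j; rewrite addn1 => le_j; rewrite summxE.
case: eqP => [j_eq|/eqP j_neq].
  rewrite -(sum_natr_root_of_unity xi1 xib1) mulr_suml; apply: eq_bigr => d _.
  by rewrite !mxE j_eq leqnSn subSnn expr1 divr1 mulrA [xi ^+ d * _]mulrC.
have le_ji : (j <= i)%N by rewrite -ltnS ltn_neqAle j_neq.
have [ij|neq_ij] := eqVneq i j.
  rewrite -[RHS](sum_root_of_unity xi1 xib1); apply: eq_bigr => d _.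
  by rewrite !mxE ij leqnn subnn expr0 divr1 mulr1.
apply: big1 => d _; rewrite !mxE leqNgt.
by rewrite [(j < i)%N]ltn_neqAle le_ji eq_sym val_eqE neq_ij /= mulr0.
Qed.

(** * Factoring the generating series *)

(** Splitting off the last digit, n = q b + d, turns s_b(n) x + n y into
    d (x + y) + (s_b(q) x + q (b y)); hence the induction over all y. *)
Lemma sum_digits_texp b (xi x : K) N y : (1 < b)%N ->
  \sum_(n < b ^ N)
     xi ^+ digit_sum b n *: texp ((digit_sum b n)%:R * x + n%:R * y)
  = \prod_(i < N) \sum_(d < b) xi ^+ d *: texp (d%:R * (x + b%:R ^+ i * y)).
Proof.
move=> b_gt1; elim: N y => [|N IHN] y.
  by rewrite big_ord1 big_ord0 /digit_sum big_ord0 !mul0r addr0 scale1r texp0.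
pose G n := xi ^+ digit_sum b n *: texp ((digit_sum b n)%:R * x + n%:R * y).
rewrite -(big_mkord predT G) expnSr big_nat_mul big_mkord big_ord_recl.
rewrite (eq_bigr (fun i : 'I_N =>
  \sum_(d < b) xi ^+ d *: texp (d%:R * (x + b%:R ^+ i * (b%:R * y))))) => [|i _]; last first.
  by rewrite /= /bump add1n; under eq_bigr do rewrite exprSr -mulrA.
rewrite -IHN big_distrlr exchange_big /=; apply: eq_bigr => q _.
rewrite -{1}[(q * b)%N]add0n big_addn mulSn addnK big_mkord; apply: eq_bigr => d _.
rewrite /G addnC digit_sumMD // -scalerAl -scalerAr scalerA -texpD addnC exprD.
by congr (_ *: texp _); rewrite !natrD natrM expr0; ring.
Qed.

(** Over independent indices the generating series factors: both xi ^ s and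
    exp (c t) turn the sums in their arguments into products. *)
Lemma sum_dffun_texp (I : finType) (T : I -> finType) (xi : K)
    (s : forall i, T i -> nat) (c : forall i, T i -> K) :
  \sum_(f : {dffun forall i, T i})
     xi ^+ (\sum_i s i (f i))%N *: texp (\sum_i c i (f i))
  = \prod_i \sum_(k : T i) xi ^+ s i k *: texp (c i k).
Proof.
rewrite bigA_distr_dffun; apply: eq_bigr => f _.
elim/big_rec3: _ => [|i A k a _ <-]; first by rewrite texp0 scale1r.
by rewrite exprD texpD -scalerAl -scalerAr scalerA.
Qed.

End TruncatedSeries.

(** * The identity *)

Section Identity.

Variables (K : numFieldType) (r : nat) (N : 'I_r -> nat) (x y : 'I_r -> K).

Lemma sum_digit_sum_power b (xi : K) :
  (1 < b)%N -> xi != 1 -> xi ^+ b = 1 ->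
  \sum_(n : {dffun forall j : 'I_r, 'I_(b ^ N j)})
     xi ^+ (\sum_(j < r) digit_sum b (n j))%N *
     (\sum_(j < r) ((digit_sum b (n j))%:R * x j + (n j)%:R * y j))
       ^+ (\sum_(j < r) N j)%N
  = (b%:R / (xi - 1)) ^+ (\sum_(j < r) N j)%N *
    ((\sum_(j < r) N j)%N)`!%:R *
    \prod_(j < r) \prod_(i < N j) (x j + b%:R ^+ i * y j).
Proof.
move=> b_gt1 xi1 xib1; set M := (\sum_(j < r) N j)%N.
pose c j (k : 'I_(b ^ N j)) := (digit_sum b k)%:R * x j + k%:R * y j.
have factored := sum_dffun_texp M xi (fun j (k : 'I_(b ^ N j)) => digit_sum b k) c.
rewrite (eq_bigr _ (fun j _ => sum_digits_texp M xi (x j) (N j) (y j) b_gt1)) in factored.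
have lead : has_lead M (\prod_(j < r) \prod_(i < N j)
    (b%:R / (xi - 1) * (x j + b%:R ^+ i * y j)))
  (\prod_(j < r) \prod_(i < N j)
    \sum_(d < b) xi ^+ d *: texp M (d%:R * (x j + b%:R ^+ i * y j))).
  apply: has_lead_prod => j; rewrite -[X in has_lead X]card_ord -sum1_card.
  by apply: has_lead_prod => i; apply: has_lead_digit_factor.
(* the corner entry is the coefficient of t ^ M *)
have := lead ord0 ord_max (leqnn _); rewrite eqxx -factored summxE.
under [in RHS]eq_bigr => j _ do rewrite big_split prodr_const card_ord.
rewrite big_split prodrXr /= -/M => corner.
rewrite mulrAC -corner mulr_suml; apply: eq_bigr => n _.
by rewrite !mxE /= subn0 -mulrA divfK // pnatr_eq0 -lt0n fact_gt0.
Qed.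

End Identity.

Theorem theorem13 (R : realType) (r : nat) (N : 'I_r -> nat)
    (r_ge1 : (1 <= r)%N) (N_gt0 : forall j, (0 < N j)%N)
    (x y : 'I_r -> R[i]) :
  (forall (b : nat) (xi : R[i]), (2 <= b)%N -> xi != 1 -> xi ^+ b = 1 ->
     \sum_(n : {dffun forall j : 'I_r, 'I_(b ^ N j)})
        xi ^+ (\sum_(j < r) digit_sum b (n j))%N *
        (\sum_(j < r) ((digit_sum b (n j))%:R * x j + (n j)%:R * y j))
          ^+ (\sum_(j < r) N j)%N
     = (b%:R / (xi - 1)) ^+ (\sum_(j < r) N j)%N *
       ((\sum_(j < r) N j)%N)`!%:R *
       \prod_(j < r) \prod_(i < N j) (x j + b%:R ^+ i * y j))
  /\
  \sum_(n : {dffun forall j : 'I_r, 'I_(2 ^ N j)})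
     (-1) ^+ (\sum_(j < r) digit_sum 2 (n j))%N *
     (\sum_(j < r) ((digit_sum 2 (n j))%:R * x j + (n j)%:R * y j))
       ^+ (\sum_(j < r) N j)%N
  = (-1) ^+ (\sum_(j < r) N j)%N *
    ((\sum_(j < r) N j)%N)`!%:R *
    \prod_(j < r) \prod_(i < N j) (x j + 2%:R ^+ i * y j).
Proof.
split=> [b xi b_gt1 xi1 xib1|]; first exact: sum_digit_sum_power.
have neg1 : -1 != 1 :> R[i] by rewrite -subr_eq0 -opprD oppr_eq0 -mulr2n pnatr_eq0.
rewrite sum_digit_sum_power // ?sqrrN ?expr1n //.
by rewrite -opprD -mulr2n invrN mulrN divff ?pnatr_eq0.
Qed.
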